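(* Let $G$ and $H$ be graphs, each of order at least $2$, and let $k$ be a positive integer with $k\le\mathcal{C}(G+H)$. The following are equivalent: (i) there exist a $k$-adjacency basis $A_G$ of $G$ and a $k$-adjacency basis $A_H$ of $H$ such that $|(A_G\setminus N_G(x))\cup(A_H\setminus N_H(y))|\ge k$ for all $x\in V(G)$ and $y\in V(H)$; (ii) $\operatorname{adim}_k(G+H)=\operatorname{adim}_k(G)+\operatorname{adim}_k(H)$.
   Context: All graphs are finite and simple; $N_G(x)$ is the open neighbourhood of $x$ in $G$. The join $G+H$ of vertex-disjoint graphs has vertex set $V(G)\cup V(H)$ and edges $E(G)\cup E(H)\cup\{uv:u\in V(G),v\in V(H)\}$. For a graph $G=(V,E)$, $d_{G,2}(x,y)=\min\{d_G(x,y),2\}$ with $d_G$ the shortest-path distance ($\infty$ between different components). For distinct $x,y$, $\mathcal{C}_G(x,y)=\{z\in V: d_{G,2}(x,z)\ne d_{G,2}(y,z)\}$, $\mathcal{C}(G)=\min_{x\ne y}|\mathcal{C}_G(x,y)|$. A set $S\subseteq V$ is a $k$-adjacency generator if $|S\cap\mathcal{C}_G(x,y)|\ge k$ for all distinct $x,y$; a minimum one is a $k$-adjacency basis, of cardinality $\operatorname{adim}_k(G)$. *)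

(* Defs.v *)
From mathcomp Require Import all_boot.

Set Implicit Arguments.
Unset Strict Implicit.
Unset Printing Implicit Defensive.

Record sgraph := SGraph {
  vertex :> finType;
  adj : rel vertex;
  adj_sym : symmetric adj;
  adj_irr : irreflexive adj
}.

Section Graph.

Variable G : sgraph.
Implicit Types (x y : G) (S : {set G}) (k : nat).

Definition nbhd x : {set G} := [set y | adj x y].

Definition walk x y (n : nat) : bool :=
  [exists p : n.-tuple G, path (@adj G) x p && (last x p == y)].

Lemma connect_walk x y : connect (@adj G) x y -> exists n, walk x y n.
Proof.
case/connectP=> p xp ->; exists (size p).
by apply/existsP; exists (in_tuple p); rewrite /= xp eqxx.
Qed.

(* [None] stands for an infinite distance. *)
Definition dist x y : option nat :=
  match @idP (connect (@adj G) x y) with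
  | ReflectT xy => Some (ex_minn (connect_walk xy))
  | ReflectF _ => None
  end.

Definition dist2 x y : nat := if dist x y is Some d then minn d 2 else 2.

Definition distinguish x y : {set G} := [set z | dist2 x z != dist2 y z].

(* The default value #|G| bounds all the terms, so it plays no role as soon as
   G has two distinct vertices. *)
Definition min_distinguish : nat :=
  \big[minn/#|G|]_(p : G * G | p.1 != p.2) #|distinguish p.1 p.2|.

Definition adj_generator k S : bool :=
  [forall x, forall y, (x != y) ==> (k <= #|S :&: distinguish x y|)].

Definition adj_basis k S : bool :=
  adj_generator k S &&
  [forall S' : {set G}, adj_generator k S' ==> (#|S| <= #|S'|)].

(* The whole vertex set is a k-adjacency generator whenever there is one;
   otherwise [adim k] is meaningless and takes the junk value #|G|. *)
Definition adim k : nat := #|[arg min_(S < setT | adj_generator k S) #|S|]|.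

End Graph.

Section Join.

Variables G H : sgraph.

Definition join_adj : rel (G + H) := fun u v =>
  match u, v with
  | inl x, inl x' => adj x x'
  | inr y, inr y' => adj y y'
  | _, _ => true
  end.

Lemma join_adj_sym : symmetric join_adj.
Proof. by move=> [x|y] [x'|y'] //=; rewrite adj_sym. Qed.

Lemma join_adj_irr : irreflexive join_adj.
Proof. by move=> [x|y] /=; rewrite adj_irr. Qed.

Definition join : sgraph := SGraph join_adj_sym join_adj_irr.

(* Disjoint union, as a set of vertices of the join. *)
Definition join_set (A : {set G}) (B : {set H}) : {set join} :=
  [set inl x | x in A] :|: [set inr y | y in B].

End Join.

(* Main.v *)
(* Inside a join, two vertices of G are distinguished by the same vertices of G
   as before and by no vertex of H, and symmetrically; x in G and y in H are
   distinguished exactly by the vertices outside N_G(x) and N_H(y).  Hence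
   A + B generates G + H iff A generates G, B generates H and the mixed
   condition holds, and the equivalence follows by comparing cardinals. *)
Require Import Defs.
From mathcomp Require Import all_boot.

Section Graph.

Variable G : sgraph.
Implicit Types (x y : G) (S : {set G}) (k : nat).

Lemma walk0 x y : walk x y 0 = (x == y).
Proof.
apply/existsP/eqP => [[p]|->]; first by rewrite tuple0 => /eqP.
by exists [tuple]; rewrite /= eqxx.
Qed.

Lemma walk1 x y : walk x y 1 = adj x y.
Proof.
apply/existsP/idP => [[p]|xy]; last by exists [tuple y]; rewrite /= xy eqxx.
by case/tupleP: p => z p; rewrite tuple0 /= andbT => /andP[xz /eqP <-].
Qed.

(** Truncation at 2 forgets all but walks of length 0 and 1, which are equality and adjacency;
    longer minimal walks and infinite distance both give 2. Distances in the join thus become a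
    matter of adjacency alone. *)
Lemma dist2E x y : dist2 x y = if x == y then 0 else if adj x y then 1 else 2.
Proof.
rewrite /dist2 /dist; destruct (@idP (connect (@adj G) x y)) as [xy|nxy]; last first.
  case: eqP => [eq_xy|_]; first by case: nxy; rewrite eq_xy connect0.
  by case: ifP => // /connect1.
case: ex_minnP => -[|[|n]] w minw.
- by rewrite -walk0 w.
- by rewrite -walk0 -walk1 w; case: ifP => // /minw.
- rewrite -walk0 -walk1; case: ifP => [/minw //|_].
  by case: ifP => [/minw //|_].
Qed.

Lemma adj_generatorP k S :
  reflect (forall x y, x != y -> k <= #|S :&: distinguish x y|)
          (adj_generator k S).
Proof.
apply: (iffP forallP) => [genS x y xy|genS x].
  by move/forallP/(_ y)/implyP: (genS x); apply.
by apply/forallP => y; apply/implyP/genS.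
Qed.

Lemma adj_basisP k S : adj_generator k [set: G] ->
  reflect (adj_generator k S /\ #|S| = adim G k) (adj_basis k S).
Proof.
rewrite /adim => genT; case: arg_minnP => // B genB minB.
apply: (iffP andP) => -[genS].
  move/forallP/(_ B)/implyP/(_ genB) => leSB; split=> //.
  by apply/eqP; rewrite eqn_leq leSB minB.
by move=> ->; split=> //; apply/forallP => S'; apply/implyP/minB.
Qed.

Lemma adim_le k S : adj_generator k S -> adim G k <= #|S|.
Proof.
move=> genS; rewrite /adim.
(* Enlarging a generator keeps it one, so the existence of [S] already makes [adim] a genuine
   minimum rather than its junk value. *)
have genT : adj_generator k [set: G].
  apply/adj_generatorP => x y xy.
  apply: leq_trans (adj_generatorP _ _ genS x y xy) _.
  by rewrite subset_leq_card // setSI // subsetT.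
by case: arg_minnP => // B _; apply.
Qed.

Lemma adim_attained k : adj_generator k [set: G] ->
  exists2 S : {set G}, adj_generator k S & #|S| = adim G k.
Proof. by rewrite /adim => genT; case: arg_minnP => // B genB _; exists B. Qed.

Lemma min_distinguish_generator k :
  k <= min_distinguish G -> adj_generator k [set: G].
Proof.
move=> le_k; apply/adj_generatorP => x y xy; rewrite setTI.
apply: leq_trans le_k _; rewrite /min_distinguish.
(* The pair [(x, y)] occurs in the enumeration, so the iterated minimum lies below its term whatever
   the default value is. *)
elim: (index_enum _) (mem_index_enum (x, y)) => // p s IHs.
rewrite inE big_cons => /predU1P[<-|/IHs le_s]; first by rewrite /= xy geq_minl.
by case: ifP => // _; apply: leq_trans (geq_minr _ _) le_s.
Qed.

End Graph.

Section Join.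

Variables G H : sgraph.
Implicit Types (A : {set G}) (B : {set H}) (S : {set join G H}).

Lemma in_join_set A B (z : join G H) :
  (z \in join_set A B) = match z with inl x => x \in A | inr y => y \in B end.
Proof.
rewrite inE; case: z => z.
  rewrite (mem_imset _ _ (@inl_inj _ _)) orbC.
  by case: imsetP => // -[].
rewrite (mem_imset _ _ (@inr_inj _ _)).
by case: imsetP => // -[].
Qed.

Lemma join_setI A A' B B' :
  join_set A B :&: join_set A' B' = join_set (A :&: A') (B :&: B').
Proof. by apply/setP => z; rewrite inE !in_join_set; case: z => z; rewrite inE. Qed.

Lemma card_join_set A B : #|join_set A B| = #|A| + #|B|.
Proof.
rewrite cardsU !card_imset; [|exact: inr_inj|exact: inl_inj].
rewrite (_ : _ :&: _ = set0) ?cards0 ?subn0 //.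
by apply/setP => z; rewrite !inE; apply/andP => -[/imsetP[x _ ->] /imsetP[]].
Qed.

(** Every vertex set of the join splits into its two traces, so [join_generatorP] applies to all
    generators of the join. *)
Lemma join_set_preim S : join_set (inl @^-1: S) (inr @^-1: S) = S.
Proof. by apply/setP => -[z|z]; rewrite in_join_set inE. Qed.

Lemma distinguish_inl (x x' : G) :
  @distinguish (join G H) (inl x) (inl x') = join_set (distinguish x x') set0.
Proof. by apply/setP => -[z|z]; rewrite in_join_set !inE !dist2E. Qed.

Lemma distinguish_inr (y y' : H) :
  @distinguish (join G H) (inr y) (inr y') = join_set set0 (distinguish y y').
Proof. by apply/setP => -[z|z]; rewrite in_join_set !inE !dist2E. Qed.

(** A vertex [z] of [G] is at distance 1 from [y], so it distinguishes the pair unless it is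
    adjacent to [x]; [x] itself counts, being at distance 0. The same holds in [H] with the roles
    exchanged. *)
Lemma distinguish_inl_inr (x : G) (y : H) :
  @distinguish (join G H) (inl x) (inr y) = join_set (~: nbhd x) (~: nbhd y).
Proof.
apply/setP => -[z|z]; rewrite in_join_set !inE !dist2E /=.
  by rewrite (inj_eq inl_inj); case: (x =P z) => [->|_]; rewrite ?adj_irr //; case: adj.
by rewrite (inj_eq inr_inj); case: (y =P z) => [->|_]; rewrite ?adj_irr //; case: adj.
Qed.

Lemma join_generatorP k A B :
  reflect [/\ adj_generator k A, adj_generator k B
            & forall (x : G) (y : H),
                k <= #|join_set (A :\: nbhd x) (B :\: nbhd y)|]
          (adj_generator k (join_set A B)).
Proof.
apply: (iffP (adj_generatorP _ _ _)) => [gen|[/adj_generatorP genA /adj_generatorP genB mix]].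
  split=> [||x y].
  - apply/adj_generatorP => x x' xx'; move: (gen (inl x) (inl x') xx').
    by rewrite distinguish_inl join_setI card_join_set setI0 cards0 addn0.
  - apply/adj_generatorP => y y' yy'; move: (gen (inr y) (inr y') yy').
    by rewrite distinguish_inr join_setI card_join_set setI0 cards0.
  - by move: (gen (inl x) (inr y) isT); rewrite distinguish_inl_inr join_setI !setDE.
move=> [x|y] [x'|y'] neq.
- by rewrite distinguish_inl join_setI card_join_set setI0 cards0 addn0 genA.
- by rewrite distinguish_inl_inr join_setI -!setDE mix.
- have -> : @distinguish (join G H) (inr y) (inl x') = @distinguish (join G H) (inl x') (inr y).
    by apply/setP => z; rewrite !inE eq_sym.
  by rewrite distinguish_inl_inr join_setI -!setDE mix.
- by rewrite distinguish_inr join_setI card_join_set setI0 cards0 genB.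
Qed.

End Join.

Theorem theorem47 (G H : sgraph) (k : nat)
    (hG : 2 <= #|G|) (hH : 2 <= #|H|)
    (hk : 0 < k) (hkC : k <= min_distinguish (join G H)) :
  (exists (AG : {set G}) (AH : {set H}),
      [/\ adj_basis k AG,
          adj_basis k AH
        & forall (x : G) (y : H),
            k <= #|join_set (AG :\: nbhd x) (AH :\: nbhd y)|])
  <-> adim (join G H) k = adim G k + adim H k.
Proof.
have genT := min_distinguish_generator _ _ hkC.
(* The bound on [k] concerns the join only; passing to the traces of its full vertex set shows that
   [adim G k] and [adim H k] are genuine minima too. *)
have [genTG genTH _] : [/\ adj_generator k [set: G], adj_generator k [set: H]
    & forall x y, k <= #|join_set ([set: G] :\: nbhd x) ([set: H] :\: nbhd y)|].
  by apply/join_generatorP; move: genT; rewrite -{1}(join_set_preim _ _ setT) !preimsetT.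
have [S genS cardS] := adim_attained _ _ genT.
move: genS cardS; rewrite -(join_set_preim _ _ S) card_join_set.
set A := _ @^-1: S; set B := _ @^-1: S.
case/join_generatorP=> genA genB mixAB cardAB.
have leA := adim_le _ _ _ genA; have leB := adim_le _ _ _ genB.
split=> [[AG [AH [/(adj_basisP _ _ _ genTG)[genG cG] /(adj_basisP _ _ _ genTH)[genH cH] mix]]]|eq_adim].
  (* The traces [A] and [B] always give the lower bound; the mixed condition makes the union of the
     two bases a generator, hence the upper bound. *)
  apply/eqP; rewrite eqn_leq -{2}cardAB leq_add // andbT -cG -cH -card_join_set.
  by apply: adim_le; apply/join_generatorP.
(* Each trace has at least the minimum size and the sums agree, so both traces are bases. *)
have eqA : #|A| = adim G k.
  apply/eqP; rewrite eqn_leq leA andbT -(leq_add2r #|B|) cardAB eq_adim.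
  by rewrite leq_add2l.
have eqB : #|B| = adim H k by apply/(@addnI #|A|); rewrite cardAB eq_adim eqA.
by exists A, B; split=> //; apply/adj_basisP.
Qed.
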